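(* Every multivision game has a winning strategy for precisely one of the two players. The $P$-positions of a multivision game are precisely the positions $u$ for which $M_u$ is a perfect square.
   Context: Let $p_1=2,p_2=3,p_3=5,\dots$ be the increasing sequence of all primes. A multivision game $\Gamma$ is a two-player game, the players moving alternately, specified by an initial position consisting of $m$ piles of tokens of sizes $n_1,\dots,n_m$ (positive integers). Put $M=M_\Gamma=\prod_{i=1}^m n_i$, and let $M>1$. Let $p_j$ be the smallest and $p_{j+k}$ the largest prime dividing the initial product $M_\Gamma$, with $k>0$; these are fixed throughout the game, and the primes $p_j<p_{j+1}<\dots<p_{j+k}$ are consecutive primes (an intermediate prime need not divide $M_\Gamma$). A move: the player selects a pile of size $n_i>1$ and a prime $p_h$ dividing $n_i$, and replaces $n_i$ by $\frac{n_i}{p_h}\prod_{l=h+1}^{j+k}p_l^{t_l}$, where the $t_l$ are arbitrary nonnegative integers chosen by the player (the product is $1$ if $h=j+k$); the other piles are unchanged. The positions of $\Gamma$ are the tuples of pile sizes that can arise in play, including the initial one. For a position $u$, $M_u$ denotes the product of the pile sizes in $u$. Play terminates when all piles have size $1$ (equivalently $M_u=1$), since no move is then possible; the player reaching this position wins and the opponent loses. A position $u$ is a $P$-position if the previous player, i.e. the opponent of the player who is to move from $u$, can force a win (in particular the position with all piles of size $1$ is a $P$-position); it is an $N$-position if the next player, i.e. the player who is to move from $u$, can force a win. *)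

(* Defs.v *)
From mathcomp Require Import all_boot.
Set Implicit Arguments.
Unset Strict Implicit.
Unset Printing Implicit Defensive.

Definition pile_prod m (u : m.-tuple nat) : nat := \prod_(i < m) tnth u i.

Record multivision (m : nat) := Multivision {
  init : m.-tuple nat;
  init_gt0 : forall i : 'I_m, 0 < tnth init i;
  init_prod_gt1 : 1 < pile_prod init;
  init_two_primes : pdiv (pile_prod init) < max_pdiv (pile_prod init)
}.

Definition max_prime m (G : multivision m) : nat := max_pdiv (pile_prod (init G)).

(* The factor ranges over all primes q with p < q <= max_prime G, whether or
   not they divide the initial product. *)
Definition move m (G : multivision m) (u v : m.-tuple nat) : Prop :=
  exists (i : 'I_m) (p : nat) (t : nat -> nat),
    [/\ 1 < tnth u i,
        prime p,
        p %| tnth u i,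
        tnth v i = tnth u i %/ p *
          \prod_(p.+1 <= q < (max_prime G).+1 | prime q) q ^ t q
      & forall j : 'I_m, j != i -> tnth v j = tnth u j].

Definition terminal m (u : m.-tuple nat) : Prop :=
  forall i : 'I_m, tnth u i = 1.

(* Only w 0, ..., w n matter. *)
Definition play m (G : multivision m) (u : m.-tuple nat)
    (w : nat -> m.-tuple nat) (n : nat) : Prop :=
  w 0 = u /\ forall k, k < n -> move G (w k) (w k.+1).

Definition is_position m (G : multivision m) (u : m.-tuple nat) : Prop :=
  exists w n, play G (init G) w n /\ w n = u.

(* The players are named relative to the position from which play is
   considered: Next is to move there, Previous is the opponent. *)
Inductive player := Next | Previous.

Definition opponent (a : player) : player :=
  if a is Next then Previous else Next.

(* The player to move after n moves. *)
Definition mover (n : nat) : player := if odd n then Previous else Next.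

(* A strategy maps the sequence of positions visited so far, ending with the
   current one, to the position to move to. *)
Definition strategy m := seq (m.-tuple nat) -> m.-tuple nat.

Definition follows m (a : player) (s : strategy m)
    (w : nat -> m.-tuple nat) (n : nat) : Prop :=
  forall k, k < n -> mover k = a -> w k.+1 = s (mkseq w k.+1).

(* Whatever the opponent does, s always provides a legal move, every play that
   ends has its last position reached by a, and no play goes on forever.  When
   u itself is terminal, the player having reached it is Previous. *)
Definition winning_strategy m (G : multivision m) (u : m.-tuple nat)
    (a : player) (s : strategy m) : Prop :=
  forall w : nat -> m.-tuple nat,
    (forall n, play G u w n -> follows a s w n ->
       (terminal (w n) -> a = opponent (mover n)) /\
       (~ terminal (w n) -> mover n = a ->
          move G (w n) (s (mkseq w n.+1)))) /\
    ~ (forall n, play G u w n /\ follows a s w n).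

Definition can_force_win m (G : multivision m) (u : m.-tuple nat)
    (a : player) : Prop :=
  exists s : strategy m, winning_strategy G u a s.

Definition P_position m (G : multivision m) (u : m.-tuple nat) : Prop :=
  is_position G u /\ can_force_win G u Previous.

(* Main.v *)
Require Import Defs.
From mathcomp Require Import all_boot.

(** A move at the prime [p] lowers the exponent of [p] in the pile product by
    one, leaves the exponents of all smaller primes unchanged and sets no
    condition on the exponents of the larger primes up to [max_prime G].  Only
    these exponents matter, and a product is a perfect square exactly when all
    of them are even.

    A move from a square makes the exponent of [p] odd, so it never ends in a
    square ([not_square_step]).  From a nonsquare there is always a move to a
    square: play at the least prime [p] of odd exponent, and add one copy of
    each larger prime of odd exponent ([replyP], [reply_square]).  The
    exponents below [p] are already even, which is why the least such prime has
    to be taken.  A player who always answers a nonsquare in this way hands over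
    squares only; the terminal product [1] is a square, so that player is never
    the one who faces the terminal position.

    Every play ends because the vectors of exponents of the primes up to
    [max_prime G] strictly decrease in the lexicographic order, the smallest
    prime being the most significant ([no_lex_descent]).  So from each position
    one player has a winning strategy ([winner_wins]).  Two strategies for
    opposite players cannot both be winning: played against each other they
    produce a play that can neither end nor go on forever ([not_both_win]). *)

Set Implicit Arguments.
Unset Strict Implicit.
Unset Printing Implicit Defensive.

(** * Lexicographic descent *)

(** Downward induction on the least coordinate [r] at which the descent may
    happen.  Between two drops of [e ^~ r] the sequence is a descent
    from [r.+1] on, and [e ^~ r] itself never increases, so the outer
    hypothesis excludes every sequence with no drop at [r] and an induction on
    the first value of [e ^~ r] excludes the others. *)
Lemma no_lex_descent_from (B r : nat) (e : nat -> nat -> nat) :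
  ~ forall k, exists2 p, r <= p <= B &
      e k.+1 p < e k p /\ forall q, q < p -> e k.+1 q = e k q.
Proof.
have [d] := ubnP (B.+1 - r); elim: d => // d IHd in r e *.
rewrite ltnS => le_d.
have [c] := ubnP (e 0 r); elim: c => // c IHc in e *.
rewrite ltnS => le_c lexe.
have le_rB : r <= B by have [p /andP[le_rp le_pB] _] := lexe 0; apply: leq_trans le_pB.
have noninc k : e k r <= e 0 r.
  elim: k => // k IHk; apply: leq_trans IHk.
  have [p /andP[le_rp _] [lt_p eq_p]] := lexe k.
  by move: le_rp; rewrite leq_eqVlt => /predU1P[->|/eq_p ->] //; apply: ltnW.
apply: (IHd r.+1 e) => [|k].
  by move: le_d; rewrite subSn // subSS; apply: leq_ltn_trans.
have [p /andP[le_rp le_pB] [lt_p eq_p]] := lexe k.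
exists p => //; rewrite le_pB andbT ltn_neqAle le_rp andbT.
apply/eqP => eq_rp; apply: (IHc (fun n => e (k.+1 + n))) => [|n].
  by rewrite addn0; apply: leq_trans le_c; apply: leq_trans (noninc k); rewrite eq_rp.
by rewrite addnS; apply: lexe.
Qed.

Lemma no_lex_descent (B : nat) (e : nat -> nat -> nat) :
  ~ forall k, exists2 p, p <= B &
      e k.+1 p < e k p /\ forall q, q < p -> e k.+1 q = e k q.
Proof. exact: (@no_lex_descent_from B 0). Qed.

(** * Prime exponents and perfect squares *)

Definition refill (p P : nat) (t : nat -> nat) : nat :=
  \prod_(p.+1 <= q < P.+1 | prime q) q ^ t q.

Lemma refill_gt0 p P t : 0 < refill p P t.
Proof. by apply: prodn_cond_gt0 => q /prime_gt0 q_gt0; rewrite expn_gt0 q_gt0. Qed.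

Lemma logn_prod (I : Type) (r : seq I) (A : pred I) (F : I -> nat) q :
  (forall i, A i -> 0 < F i) ->
  logn q (\prod_(i <- r | A i) F i) = \sum_(i <- r | A i) logn q (F i).
Proof.
move=> F_gt0; suff [] : 0 < \prod_(i <- r | A i) F i /\
  logn q (\prod_(i <- r | A i) F i) = \sum_(i <- r | A i) logn q (F i) by [].
elim/big_rec2: _ => [|i y x Ai [x_gt0 <-]]; first by rewrite logn1.
by rewrite muln_gt0 F_gt0 // lognM ?F_gt0.
Qed.

Lemma logn_refill p P t q :
  logn q (refill p P t) = if (p < q <= P) && prime q then t q else 0.
Proof.
rewrite logn_prod => [|r /prime_gt0 r_gt0]; last by rewrite expn_gt0 r_gt0.
rewrite -[q <= P]ltnS -(big_nat1_cond_eq addn t) big_mkcondr.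
apply: eq_bigr => r pr_r; rewrite lognX logn_prime // eq_sym.
by case: eqP; rewrite ?muln1 ?muln0.
Qed.

Definition is_square (M : nat) : bool :=
  ~~ has (fun p => odd (logn p M)) (primes M).

Lemma is_squareP M : reflect (forall p, odd (logn p M) = false) (is_square M).
Proof.
apply: (iffP hasPn) => [even_M p | even_M p _]; last by rewrite even_M.
apply/negP => odd_p; have := even_M p.
by rewrite odd_p -logn_gt0 odd_gt0 // => /(_ isT).
Qed.

(** The root is rebuilt from the halved exponents; [refill 0 M] ranges over all
    primes up to [M], hence over all prime divisors of [M]. *)
Lemma squareP M : 0 < M -> reflect (exists r, M = r ^ 2) (is_square M).
Proof.
move=> M_gt0; apply: (iffP (is_squareP M)) => [even_M | [r ->] p]; last first.
  by rewrite lognX mul2n odd_double.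
exists (refill 0 M (fun q => (logn q M)./2)).
apply: eqn_from_log; rewrite // ?expn_gt0 ?refill_gt0 // => q.
rewrite lognX logn_refill; case: ifP => [_|].
  by rewrite mul2n even_halfK ?even_M.
rewrite muln0 => /negP out; apply/eqP; rewrite -leqn0 leqNgt logn_gt0 mem_primes.
by apply/negP => /and3P[pr_q _ q_dvd]; case: out; rewrite prime_gt0 // dvdn_leq.
Qed.

(** * The effect of a move on the pile product *)

(** No prime above the bound ever enters the pile product
    ([position_smooth]); this keeps the exponents inside the finitely many
    coordinates to which [no_lex_descent] applies, and lets [reply] correct
    every odd exponent above the prime at which it plays. *)
Definition smooth (P M : nat) : Prop :=
  0 < M /\ forall p, prime p -> p %| M -> p <= P.

(** The equation has [p] multiplied to the left rather than divided out on the
    right, so that it turns into an equation between sums of exponents with no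
    truncated subtraction. *)
Definition step (P p : nat) (t : nat -> nat) (M N : nat) : Prop :=
  [/\ prime p, p %| M & N * p = M * refill p P t].

Lemma step_logn P p t M N : 0 < M -> step P p t M N ->
  0 < N /\ forall q,
    logn q N + (q == p) =
    logn q M + (if (p < q <= P) && prime q then t q else 0).
Proof.
move=> M_gt0 [pr_p p_dvd defN].
have : 0 < N * p by rewrite defN muln_gt0 M_gt0 refill_gt0.
rewrite muln_gt0 => /andP[N_gt0 p_gt0]; split=> // q.
by rewrite -logn_prime // -lognM // defN lognM ?refill_gt0 // logn_refill.
Qed.

Lemma step_at P p t M N : 0 < M -> step P p t M N -> (logn p N).+1 = logn p M.
Proof.
by move=> M_gt0 /(step_logn M_gt0)[_ /(_ p)]; rewrite eqxx ltnn addn0 addn1.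
Qed.

Lemma step_below P p t M N q :
  0 < M -> step P p t M N -> q < p -> logn q N = logn q M.
Proof.
move=> M_gt0 /(step_logn M_gt0)[_ /(_ q) logN] lt_qp; move: logN.
by rewrite (ltn_eqF lt_qp) ltnNge (ltnW lt_qp) /= !addn0.
Qed.

Lemma step_above P p t M N q : 0 < M -> step P p t M N -> p < q ->
  logn q N = logn q M + (if (q <= P) && prime q then t q else 0).
Proof.
move=> M_gt0 /(step_logn M_gt0)[_ /(_ q) logN] lt_pq; move: logN.
by rewrite (gtn_eqF lt_pq) lt_pq addn0.
Qed.

Lemma smooth_logn P M q : smooth P M -> P < q -> logn q M = 0.
Proof.
move=> [_ smM] lt_Pq; apply/eqP; rewrite -leqn0 leqNgt logn_gt0 mem_primes.
by apply/negP => /and3P[pr_q _ /(smM q pr_q)]; rewrite leqNgt lt_Pq.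
Qed.

Lemma step_smooth P p t M N : smooth P M -> step P p t M N -> smooth P N.
Proof.
move=> smM stepMN; have [N_gt0 logN] := step_logn smM.1 stepMN.
split=> // q pr_q q_dvd; rewrite leqNgt; apply/negP => lt_Pq.
have N_q : 0 < logn q N by rewrite logn_gt0 mem_primes pr_q N_gt0.
have /eqP := logN q; rewrite (smooth_logn smM lt_Pq) [q <= P]leqNgt lt_Pq andbF /=.
by rewrite addn_eq0 -leqn0 leqNgt N_q.
Qed.

Lemma not_square_step P p t M N :
  0 < M -> step P p t M N -> is_square M -> ~~ is_square N.
Proof.
move=> M_gt0 stepMN /is_squareP/(_ p) even_p; apply/is_squareP => /(_ p).
by move: even_p; rewrite -(step_at M_gt0 stepMN) /= => /negbFE ->.
Qed.

Lemma no_infinite_steps P (M : nat -> nat) : smooth P (M 0) ->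
  ~ forall k, exists p t, step P p t (M k) (M k.+1).
Proof.
move=> sm0 steps; have sm k : smooth P (M k).
  by elim: k => // k IHk; have [p [t /(step_smooth IHk)]] := steps k.
apply: (@no_lex_descent P (fun k p => logn p (M k))) => k.
have [p [t stepk]] := steps k; have [M_gt0 smM] := sm k.
exists p; first by case: stepk => pr_p p_dvd _; apply: smM.
by split=> [|q]; [rewrite -(step_at M_gt0 stepk) | apply: step_below stepk].
Qed.

Lemma pile_dvd_prod m (u : m.-tuple nat) (i : 'I_m) : tnth u i %| pile_prod u.
Proof. by rewrite /pile_prod (bigD1 i) //= dvdn_mulr. Qed.

Lemma pile_step m (u v : m.-tuple nat) (i : 'I_m) P p t :
  prime p -> p %| tnth u i -> tnth v i = tnth u i %/ p * refill p P t ->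
  (forall j, j != i -> tnth v j = tnth u j) ->
  step P p t (pile_prod u) (pile_prod v).
Proof.
move=> pr_p p_dvd vi v_other; split=> //.
  exact: dvdn_trans (pile_dvd_prod u i).
rewrite /pile_prod (bigD1 i) // vi (eq_bigr (tnth u)); last by move=> j; apply: v_other.
rewrite [in RHS](bigD1 i) //=; set R := refill p P t; set rest := \prod_(j | _) _.
have {2}-> : tnth u i = tnth u i %/ p * p by rewrite divnK.
by rewrite [LHS]mulnAC (mulnAC _ R) [LHS]mulnAC.
Qed.

Lemma move_step m (G : multivision m) u v :
  move G u v -> exists p t, step (max_prime G) p t (pile_prod u) (pile_prod v).
Proof.
by move=> [i [p [t [_ pr_p p_dvd vi v_other]]]]; exists p, t; apply: pile_step vi _.
Qed.

Lemma terminal_square m (u : m.-tuple nat) : terminal u -> is_square (pile_prod u).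
Proof.
move=> u1; rewrite (_ : pile_prod u = 1) //.
by apply: big1 => i _; apply: u1.
Qed.

(** * Answering a nonsquare by a square *)

(** [primes] lists the primes in increasing order, so the head of the filtered
    list is the least prime of odd exponent; it is [0] on squares. *)
Definition least_odd_prime (M : nat) : nat :=
  head 0 [seq p <- primes M | odd (logn p M)].

Lemma least_odd_primeP M (p := least_odd_prime M) : ~~ is_square M ->
  [/\ prime p, p %| M, odd (logn p M) &
      forall q, q < p -> odd (logn q M) = false].
Proof.
rewrite negbK has_filter {}/p /least_odd_prime.
have := sorted_filter ltn_trans (fun p => odd (logn p M)) (sorted_primes M).
case def_s: [seq _ <- _ | _] => [|p s] //= path_ps _.
have : p \in [seq p <- primes M | odd (logn p M)] by rewrite def_s mem_head.
rewrite mem_filter mem_primes => /and4P[odd_p pr_p _ p_dvd]; split=> // q lt_qp.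
apply/negP => odd_q.
have : q \in [seq p <- primes M | odd (logn p M)].
  by rewrite mem_filter odd_q -logn_gt0 odd_gt0.
rewrite def_s inE (ltn_eqF lt_qp) /=.
move/(allP (order_path_min ltn_trans path_ps)).
by rewrite ltnNge (ltnW lt_qp).
Qed.

Definition reply m (G : multivision m) (u : m.-tuple nat) : m.-tuple nat :=
  let M := pile_prod u in
  let p := least_odd_prime M in
  if [pick i | p %| tnth u i] is Some i then
    [tuple if j == i then
             tnth u i %/ p * refill p (max_prime G) (fun q => odd (logn q M))
           else tnth u j | j < m]
  else u.

(** The parities serve as the numbers of added primes: with them every exponent
    above [p] becomes even. *)
Lemma replyP m (G : multivision m) u (M := pile_prod u) :
  0 < M -> ~~ is_square M ->
  move G u (reply G u) /\
  step (max_prime G) (least_odd_prime M) (fun q => odd (logn q M))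
    M (pile_prod (reply G u)).
Proof.
move=> M_gt0 /least_odd_primeP[pr_p p_dvdM _ _].
rewrite /reply -/M; set p := least_odd_prime M in pr_p p_dvdM *.
case: pickP => [i p_dvd|no_i]; last first.
  by move: p_dvdM; rewrite Euclid_dvd_prod // big1 // => i _; apply: no_i.
set v := mktuple _.
have vi : tnth v i = tnth u i %/ p *
    refill p (max_prime G) (fun q => odd (logn q M)).
  by rewrite tnth_mktuple eqxx.
have v_other j : j != i -> tnth v j = tnth u j.
  by rewrite tnth_mktuple => /negPf->.
split; last exact: pile_step vi v_other.
exists i, p, (fun q => odd (logn q M)); split=> //.
apply: leq_trans (prime_gt1 pr_p) (dvdn_leq _ p_dvd).
exact: dvdn_gt0 M_gt0 (pile_dvd_prod u i).
Qed.

Lemma reply_square m (G : multivision m) u (M := pile_prod u) :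
  smooth (max_prime G) M -> ~~ is_square M -> is_square (pile_prod (reply G u)).
Proof.
move=> smM nsqM; have M_gt0 := smM.1.
have [_ stepM] := replyP G M_gt0 nsqM.
have [pr_p p_dvd odd_p even_lt_p] := least_odd_primeP nsqM.
apply/is_squareP => q; case: (ltngtP q (least_odd_prime M)) => [lt_qp|lt_pq|->].
- by rewrite (step_below M_gt0 stepM) ?even_lt_p.
- rewrite (step_above M_gt0 stepM lt_pq).
  have [pr_q|npr_q] := boolP (prime q); last by rewrite andbF addn0 lognE (negPf npr_q).
  case: leqP => [_|lt_Pq]; first by rewrite oddD oddb addbb.
  by rewrite (smooth_logn smM).
by apply: negbTE; move: odd_p; rewrite -(step_at M_gt0 stepM).
Qed.

(** * Plays and strategies *)

Lemma position_smooth m (G : multivision m) u :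
  is_position G u -> smooth (max_prime G) (pile_prod u).
Proof.
move=> [w [n [[w0 moves] <-]]]; elim: n => [|n IHn] in moves *.
  rewrite w0; have M_gt0 := ltnW (init_prod_gt1 G); split=> // p pr_p p_dvd.
  by apply: max_pdiv_max; rewrite mem_primes pr_p M_gt0.
have [p [t]] := move_step (moves n (ltnSn n)); apply: step_smooth.
by apply: IHn => k lt_kn; apply: moves; apply: ltnW.
Qed.

Lemma last_mkseq (T : Type) (x : T) (w : nat -> T) n : last x (mkseq w n.+1) = w n.
Proof. by rewrite mkseqS last_rcons. Qed.

Lemma moverS n : mover n.+1 = opponent (mover n).
Proof. by rewrite /mover /=; case: odd. Qed.

Lemma opponentK : involutive opponent.
Proof. by case. Qed.

Lemma opponent_neq a : opponent a <> a.
Proof. by case: a. Qed.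

Definition winner m (u : m.-tuple nat) : player :=
  if is_square (pile_prod u) then Previous else Next.

(** The position alone decides the answer, so the strategy reads only the last
    entry of the history. *)
Lemma winner_wins m (G : multivision m) u :
  smooth (max_prime G) (pile_prod u) -> can_force_win G u (winner u).
Proof.
move=> sm_u; exists (fun h => reply G (last u h)) => w; set a := winner u.
split=> [n [w0 moves] follow|infinite]; last first.
  apply: (@no_infinite_steps (max_prime G) (fun k => pile_prod (w k))).
    by have [[-> _] _] := infinite 0.
  move=> k; apply: move_step.
  by have [[_ moves] _] := infinite k.+1; apply: moves.
have sm k : k <= n -> smooth (max_prime G) (pile_prod (w k)).
  elim: k => [|k IHk] lt_kn; first by rewrite w0.
  by have [p [t]] := move_step (moves k lt_kn); apply: step_smooth (IHk (ltnW lt_kn)).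
(* The winner is to move exactly at the nonsquares. *)
have turn k : k <= n ->
    mover k = if is_square (pile_prod (w k)) then opponent a else a.
  elim: k => [|k IHk] lt_kn; first by rewrite w0 /a /winner; case: is_square.
  rewrite moverS; move: (IHk (ltnW lt_kn)).
  have smk := sm k (ltnW lt_kn).
  case: ifPn => [sq_k|nsq_k] mover_k; rewrite mover_k.
    have [p [t]] := move_step (moves k lt_kn).
    by move/(not_square_step smk.1)=> /(_ sq_k)/negPf->; rewrite opponentK.
  by rewrite (follow k lt_kn mover_k) last_mkseq reply_square.
split=> [/terminal_square sq_n|_ mover_n].
  by rewrite turn // sq_n opponentK.
rewrite last_mkseq; apply: (replyP _ (sm n (leqnn n)).1 _).1.
apply/negP => sq_n; move: mover_n; rewrite turn // sq_n.
exact: opponent_neq.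
Qed.

(** Strategies read the whole history, so the play between the strategies [s]
    is built as its growing sequence of positions. *)
Fixpoint duel_history m (s : player -> strategy m) u n : seq (m.-tuple nat) :=
  if n is k.+1 then
    let h := duel_history s u k in rcons h (s (mover k) h)
  else [:: u].

(** In the play of the two strategies against each other, a terminal position
    would make both players the one who reached it.  So the play never stops,
    which no winning strategy allows. *)
Lemma not_both_win m (G : multivision m) u :
  can_force_win G u Next -> can_force_win G u Previous -> False.
Proof.
move=> [s1 win1] [s2 win2].
pose s a := if a is Next then s1 else s2.
have win a : winning_strategy G u a (s a) by case: a.
pose h := duel_history s u; pose w n := last u (h n).
have hE n : mkseq w n.+1 = h n.
  by elim: n => // n IHn; rewrite mkseqS IHn /w /= last_rcons.
have wS n : w n.+1 = s (mover n) (mkseq w n.+1) by rewrite hE /w /= last_rcons.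
have follow a n : follows a (s a) w n by move=> k _ <-; apply: wS.
have plays n : play G u w n.
  elim: n => [|n [w0 moves]]; split=> // k; rewrite ltnS leq_eqVlt.
  case/predU1P=> [->|]; last exact: moves.
  have step_n a := (win a w).1 n (conj w0 moves) (follow a n).
  rewrite wS; apply: (step_n (mover n)).2 => // end_n.
  by have := (step_n Next).1 end_n; rewrite -((step_n Previous).1 end_n).
by apply: (win Next w).2 => n; split.
Qed.

Lemma can_force_winP m (G : multivision m) u a :
  is_position G u -> can_force_win G u a <-> a = winner u.
Proof.
move/position_smooth/winner_wins => win; split=> [win_a|-> //].
move: win win_a; case: a; case: (winner u) => // win1 win2.
  by case: (not_both_win win2 win1).
by case: (not_both_win win1 win2).
Qed.

Theorem theorem2 (m : nat) (G : multivision m) :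
  (exists! a : player, can_force_win G (init G) a) /\
  (forall u : m.-tuple nat,
     P_position G u <->
     (is_position G u /\ exists r : nat, pile_prod u = r ^ 2)).
Proof.
have pos_init : is_position G (init G) by exists (fun=> init G), 0.
split=> [|u].
  exists (winner (init G)); split; first exact/can_force_winP.
  by move=> a /can_force_winP ->.
have PrevE (pos_u : is_position G u) :
    can_force_win G u Previous <-> exists r, pile_prod u = r ^ 2.
  apply: (iff_trans (can_force_winP Previous pos_u)); rewrite /winner.
  by case: (squareP (position_smooth pos_u).1) => sq; split=> // /sq.
by split=> -[pos_u] /(PrevE pos_u).
Qed.
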